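(* Let $R$ be a SPIR and let $R\subset R[t]$ be a ring extension where $t$ is either idempotent or nilpotent of index $2$. Then $R\subset R[t]$ is an FIP $\Delta$-extension.
   Context: All rings are commutative and unital. A ring $R$ is a SPIR if it is a principal ideal ring with a nonzero prime ideal $M$ such that $M$ is nilpotent (of some index $p>0$). For a ring extension $R\subseteq S$, $[R,S]$ denotes the set of all $R$-subalgebras of $S$. The extension is FIP if $[R,S]$ is finite. It is a $\Delta$-extension if $T+U\in[R,S]$ for all $T,U\in[R,S]$ (equivalently $T+U=TU$, the compositum). *)

(* Defs.v *)
From HB Require Import structures.
From mathcomp Require Import all_boot all_order all_algebra.
From mathcomp Require Import boolp classical_sets functions cardinality.

Set Implicit Arguments.
Unset Strict Implicit.
Unset Printing Implicit Defensive.

Import GRing.Theory.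

Local Open Scope ring_scope.
Local Open Scope classical_set_scope.

Section Ideals.
Variable R : comNzRingType.
Implicit Types I J M : set R.

(* Unlike [idealr_closed], this allows the unit ideal. *)
Definition is_ideal I : Prop := @GRing.submod_closed R R^o [in I].

Definition principal I : Prop := exists a : R, I = [set r * a | r in setT].

Definition principal_ideal_ring : Prop := forall I, is_ideal I -> principal I.

(* [idealr_closed] contains the condition that 1 is not in the ideal. *)
Definition prime_ideal M : Prop :=
  idealr_closed [in M] /\ prime_idealr_closed [in M].

Definition ideal_mul I J : set R :=
  [set x | exists s : seq (R * R),
     (forall p, p \in s -> I p.1 /\ J p.2) /\ x = \sum_(p <- s) p.1 * p.2].

Definition ideal_exp I (n : nat) : set R := iter n (ideal_mul I) setT.

Definition ideal_nilpotent_of_index I (p : nat) : Prop :=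
  ideal_exp I p = [set 0] /\
  forall k : nat, (k < p)%N -> ideal_exp I k <> [set 0].

End Ideals.

Definition SPIR (R : comNzRingType) : Prop :=
  principal_ideal_ring R /\
  exists M : set R, [/\ prime_ideal M, M <> [set 0]
    & exists p : nat, (0 < p)%N /\ ideal_nilpotent_of_index M p].

Definition idempotent_elt (A : comPzRingType) (t : A) : Prop := t * t = t.

Definition nilpotent_of_index (A : comPzRingType) (t : A) (n : nat) : Prop :=
  t ^+ n = 0 /\ forall k : nat, (k < n)%N -> t ^+ k <> 0.

(* A ring extension of R by S is a commutative R-algebra S whose structure
   map r |-> r%:A is injective; R is then identified with its image. *)
Section Extensions.
Variables (R : comNzRingType) (S : comAlgType R).

Definition ring_extension : Prop := injective (GRing.in_alg S).

Definition base_ring : set S := range (GRing.in_alg S).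

Definition adjoin (t : S) : set S := range (horner_alg t).

Definition subalgebras : set (set S) :=
  [set T : set S | GRing.subalg_closed [in T]].

Definition set_add (T U : set S) : set S := [set x + y | x in T & y in U].

Definition FIP : Prop := finite_set subalgebras.

Definition Delta_extension : Prop :=
  forall T U : set S, subalgebras T -> subalgebras U ->
    subalgebras (set_add T U).

End Extensions.
Arguments base_ring {R} S.
Arguments subalgebras {R} S.
Arguments ring_extension {R} S.
Arguments FIP {R} S.
Arguments Delta_extension {R} S.

(* Main.v *)
Require Import Defs.
From mathcomp Require Import all_boot all_order all_algebra.
From mathcomp Require Import boolp classical_sets functions cardinality.
From mathcomp Require Import ring.
Import GRing.Theory.
Local Open Scope ring_scope.
Local Open Scope classical_set_scope.

(** Since [t * t] is [t] or [0], [S = R + R t], and a subalgebra [T] is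
    [R + I t] for the ideal [I = {b | b t \in T}] of [R].  If [M = (m)] is a
    nilpotent nonzero prime ideal of the principal ideal ring [R], then every
    element outside [M] is invertible, so the only ideals are the [(m ^+ k)]
    with [k <= p] where [m ^+ p = 0]; hence FIP.  The Delta property only uses
    [(a + b t)(c + d t) = (a c + b c t + b d t^2) + a d t]. *)

Definition invertible {R : comNzRingType} (x : R) : Prop := exists y, x * y = 1.

Lemma invertible_mull (R : comNzRingType) (x y : R) :
  invertible (x * y) -> invertible x.
Proof. by case=> z xyz; exists (y * z); rewrite mulrA. Qed.

Lemma invertible_one_sub_nilpotent (R : comNzRingType) (x : R) (n : nat) :
  x ^+ n = 0 -> invertible (1 - x).
Proof.
move=> xn0; exists (\sum_(i < n) x ^+ i).
by have := subrX1 x n; rewrite xn0 sub0r -opprB mulNr => /oppr_inj <-.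
Qed.

(** A generator of the ideal [(a, b)] is a common divisor that comes with a Bezout relation. *)
Lemma principal_ideal_gcd (R : comNzRingType) (a b : R) :
  principal_ideal_ring R ->
  exists d r s x y, [/\ a = r * d, b = s * d & d = x * a + y * b].
Proof.
move=> pir.
pose I : set R := [set z | exists x y, z = x * a + y * b].
have [|d Id] := pir I.
  split=> [|c u v]; rewrite !inE.
    by exists 0, 0; rewrite !mul0r addr0.
  move=> -[x [y ->]] [x' [y' ->]]; exists (c * x + x'), (c * y + y').
  by rewrite /GRing.scale /=; ring.
have [r _ ra] : [set r * d | r in setT] a.
  by rewrite -Id; exists 1, 0; rewrite mul1r mul0r addr0.
have [s _ sb] : [set r * d | r in setT] b.
  by rewrite -Id; exists 0, 1; rewrite mul1r mul0r add0r.
have [x [y dxy]] : I d by rewrite Id; exists 1; rewrite ?mul1r.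
by exists d, r, s, x, y.
Qed.

(** Passes from nilpotency of an ideal to nilpotency of its elements. *)
Lemma exp_mem_ideal_exp (R : comNzRingType) (I : set R) (a : R) (n : nat) :
  I a -> ideal_exp I n (a ^+ n).
Proof.
move=> Ia; elim: n => [//|n IHn].
exists [:: (a, a ^+ n)]; rewrite big_seq1 /= exprS; split=> // q.
by rewrite inE => /eqP ->.
Qed.

(** The witness [m] generates the given prime [M]. Locality is not part of the definition of a SPIR:
    it is forced by [M] being prime, nilpotent and nonzero. *)
Lemma SPIR_uniformizer (R : comNzRingType) : SPIR R ->
  exists (m : R) (p : nat),
    m ^+ p = 0 /\ forall x, invertible x \/ exists y, x = y * m.
Proof.
case=> pir [M [[[M0 M1 Mlin] Mprime] Mn0 [p [_ [Mp _]]]]].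
have [|m Mm] := pir M; first by split.
have memM x : M x <-> exists y, x = y * m.
  rewrite {1}Mm; split=> [[y _ <-]|[y ->]]; first by exists y.
  by exists y.
have mM : M m by apply/memM; exists 1; rewrite mul1r.
have mp0 : m ^+ p = 0.
  by have := exp_mem_ideal_exp _ _ _ p mM; rewrite Mp.
have unit1 x : invertible (1 - x * m).
  by apply: (@invertible_one_sub_nilpotent _ _ p); rewrite exprMn mp0 mulr0.
have m_neq0 : m <> 0.
  move=> m0; apply: Mn0; apply/seteqP; split=> x.
    by case/memM=> y ->; rewrite m0 mulr0.
  by move=> ->; apply: set_mem.
have primeM x y : M (x * y) -> M x \/ M y.
  by move=> xyM; have := Mprime x y; rewrite !inE => /(_ xyM) /orP [];
     rewrite inE; [left|right].
(* As [d] is outside the prime [M], [m = r d] forces [r] into [M = (m)]. *)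
have absorb d r : ~ M d -> m = r * d -> exists s, m * (1 - d * s) = 0.
  move=> dM mrd; have [|/memM[s rs]//|//] := primeM r d.
  - by rewrite -mrd.
  - by exists s; rewrite mulrBr mulr1 {1}mrd rs; ring.
(* If [a] were outside [M], so would be its gcd [e] with [m], and [absorb] gives
   [m * (1 - e * w) = 0]. As [a] also kills [m], so does the unit [1 - y * w * m], whence
   [m = 0]. *)
have regular a : a * m = 0 -> M a.
  move=> am0; apply: contrapT => aM.
  have [e [r [v [x [y [ra mv eE]]]]]] := principal_ideal_gcd _ a m pir.
  have eM : ~ M e.
    by move=> /memM[z ez]; apply: aM; apply/memM; exists (r * z);
       rewrite ra ez mulrA.
  have [w mw] := absorb e v eM mv.
  have [z uz] := unit1 (y * w).
  apply: m_neq0; rewrite -[LHS]mulr1 -uz mulrA.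
  suff -> : m * (1 - y * w * m) = m * (1 - e * w) + x * w * (a * m).
    by rewrite mw am0 mulr0 addr0 mul0r.
  by rewrite eE; ring.
exists m, p; split=> // n.
have [nM|nM] := pselect (M n); first by right; apply/memM.
left.
(* The gcd [d] of [m] and [n] lies outside [M]. By [absorb] and [regular], [d * s] is 1 modulo [m],
   so [d] is a unit; the Bezout relation divided by [d] then makes [n] a unit modulo [m], hence a
   unit. *)
have [d [r [v [x [y [mr nv dE]]]]]] := principal_ideal_gcd _ m n pir.
have dM : ~ M d.
  by move=> /memM[z dz]; apply: nM; apply/memM; exists (v * z);
     rewrite nv dz mulrA.
have [s ms] := absorb d r dM mr.
have /memM[z dsz] : M (1 - d * s) by apply: regular; rewrite mulrC.
have [d' dd'] : invertible d.
  apply: (@invertible_mull _ d s); suff -> : d * s = 1 - z * m by [].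
  by rewrite -dsz; ring.
apply: (@invertible_mull _ n (y * d')).
suff -> : n * (y * d') = 1 - x * d' * m by [].
by rewrite -dd' dE; ring.
Qed.

(** Divide a generator by [m] until the quotient is a unit. If [p] divisions succeed, the generator
    is a multiple of [m ^+ p = 0], so the zero ideal is the case [k = p]. *)
Lemma SPIR_ideals (R : comNzRingType) : SPIR R ->
  exists (m : R) (p : nat), forall I, is_ideal I ->
    exists2 k, (k < p.+1)%N & I = [set r * m ^+ k | r in setT].
Proof.
move=> spir; have [m [p [mp0 mdich]]] := SPIR_uniformizer _ spir.
exists m, p => I /(proj1 spir)[x ->].
have factor n : (exists2 k, (k < n)%N & exists2 u, invertible u & x = u * m ^+ k)
    \/ exists y, x = y * m ^+ n.
  elim: n => [|n [[k kn ukx]|[y xy]]].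
  - by right; exists x; rewrite mulr1.
  - by left; exists k => //; rewrite ltnS ltnW.
  - have [yinv|[z yz]] := mdich y; first by left; exists n => //; exists y.
    by right; exists z; rewrite xy yz -mulrA -exprS.
have [[k kp [u [v uv] xu]]|[y xy]] := factor p.
- exists k; first exact: ltnW.
  apply/seteqP; split=> _ [r _ <-].
    by exists (r * u) => //; rewrite xu mulrA.
  by exists (r * v) => //; rewrite xu -[r in RHS]mulr1 -uv; ring.
- exists p => //; suff -> : x = m ^+ p by [].
  by rewrite xy mp0 mulr0.
Qed.

Section QuadraticExtension.
Context {R : comNzRingType} {S : comAlgType R} (t : S) (e : R).
(** Treats both cases at once: [e = 1] for idempotent [t], [e = 0] for [t] of square zero. *)
Hypothesis t2 : t * t = e *: t.
Hypothesis hadjoin : [set: S] = adjoin t.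

Lemma adjoin_linear (x : S) : exists a b : R, x = a%:A + b *: t.
Proof.
have [q _ <-] : adjoin t x by rewrite -hadjoin.
elim/poly_ind: q => [|q c [a [b IHq]]].
  by exists 0, 0; rewrite rmorph0 !scale0r addr0.
(* Horner step: [(a + b t) t + c = c + (a + b e) t]. *)
exists c, (a + b * e).
rewrite rmorphD rmorphM /= horner_algX horner_algC IHq mulrDl.
by rewrite -!scalerAl mul1r t2 scalerA -scalerDl addrC.
Qed.

Definition slope_ideal (T : set S) : set R := [set b | T (b *: t)].

Lemma subalgebras_lin (T : set S) : subalgebras S T ->
  [/\ forall a, T a%:A, forall x y, T x -> T y -> T (x + y),
      forall a x, T x -> T (a *: x) & forall x y, T x -> T y -> T (x * y)].
Proof.
case=> T1 Tlin TM.
have TL a x y : T x -> T y -> T (a *: x + y).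
  by move=> Tx Ty; apply: set_mem; apply: Tlin; apply: mem_set.
have T1' : T 1 by apply: set_mem.
have T0 : T 0 by have := TL (- 1) 1 1 T1' T1'; rewrite scaleN1r addNr.
split=> [a|x y Tx Ty|a x Tx|x y Tx Ty].
- by have := TL a 1 0 T1' T0; rewrite addr0.
- by have := TL 1 x y Tx Ty; rewrite scale1r.
- by have := TL a x 0 Tx T0; rewrite addr0.
- by apply: set_mem; apply: TM; apply: mem_set.
Qed.

(** Constants lie in every subalgebra and can be subtracted. This holds for any expression [a + b t]
    of an element, so the coefficients need not be unique. *)
Lemma subalgebra_mem_linear (T : set S) (a b : R) : subalgebras S T ->
  T (a%:A + b *: t) <-> slope_ideal T b.
Proof.
move=> /subalgebras_lin[TA TD _ _]; split=> [Tab|Tb]; last exact: TD.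
rewrite /slope_ideal /=; have := TD _ _ (TA (- a)) Tab.
by rewrite addrA -scalerDl addNr scale0r add0r.
Qed.

Lemma slope_ideal_is_ideal (T : set S) :
  subalgebras S T -> is_ideal (slope_ideal T).
Proof.
move=> /subalgebras_lin[TA TD TZ _]; split=> [|c u v]; rewrite !inE.
  by rewrite /slope_ideal /= scale0r -(scale0r 1).
rewrite /slope_ideal /= => Tu Tv.
by rewrite scalerDl -scalerA; apply: TD => //; apply: TZ.
Qed.

Lemma subalgebra_of_slope_ideal (T : set S) : subalgebras S T ->
  T = [set x | exists a b, slope_ideal T b /\ x = a%:A + b *: t].
Proof.
move=> hT; apply/seteqP; split=> x.
  have [a [b ->]] := adjoin_linear x => Tx.
  by exists a, b; split=> //; apply/(subalgebra_mem_linear _ a b hT).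
by case=> a [b [Tb ->]]; apply/subalgebra_mem_linear.
Qed.

Lemma FIP_adjoin : SPIR R -> FIP S.
Proof.
move=> /SPIR_ideals[m [p ideals]].
(* Each subalgebra equals some [F k] with [k <= p]; inclusion in this finite list suffices, without
   checking that [F k] is a subalgebra. *)
pose F (k : nat) : set S := [set x | exists a b,
  [set r * m ^+ k | r in setT] b /\ x = a%:A + b *: t].
apply: (@sub_finite_set _ _ (F @` `I_p.+1)); last first.
  by apply: finite_image; apply: finite_II.
move=> T hT; have [k kp Tk] := ideals _ (slope_ideal_is_ideal T hT).
by exists k => //; rewrite [RHS](subalgebra_of_slope_ideal T hT) Tk.
Qed.

Lemma Delta_extension_adjoin : Delta_extension S.
Proof.
move=> T U hT hU.
have [TA TD TZ TM] := subalgebras_lin T hT.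
have [UA UD UZ UM] := subalgebras_lin U hU.
have addP x y : T x -> U y -> set_add T U (x + y).
  by move=> Tx Uy; exists x => //; exists y.
have add_closed x y : set_add T U x -> set_add T U y -> set_add T U (x + y).
  move=> [x1 Tx1 [x2 Ux2 <-]] [y1 Ty1 [y2 Uy2 <-]].
  by rewrite addrACA; apply: addP; [apply: TD | apply: UD].
have mixed x y : T x -> U y -> set_add T U (x * y).
  have [a [b ->]] := adjoin_linear x; have [c [d ->]] := adjoin_linear y.
  move=> /(subalgebra_mem_linear _ _ _ hT) Tb /(subalgebra_mem_linear _ _ _ hU) Ud.
  have -> : (a%:A + b *: t) * (c%:A + d *: t)
      = ((a * c)%:A + (b * c + b * d * e) *: t) + a *: (d *: t).
    rewrite mulrDl !mulrDr -!scalerAl -!scalerAr !mul1r mulr1 t2 !scalerA.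
    by rewrite scalerDl addrAC.
  apply: addP; last exact: UZ.
  (* The coefficient of [t] is a multiple of [b], and [b *: t] lies in [T]. *)
  apply: TD => //; have -> : b * c + b * d * e = (c + d * e) * b by ring.
  by rewrite -scalerA; apply: TZ.
have T0 : T 0 by rewrite -(scale0r 1).
have U0 : U 0 by rewrite -(scale0r 1).
split=> [|a x y|x y]; rewrite !inE.
- by rewrite -[1]addr0; apply: addP => //; rewrite -(scale1r 1).
- move=> [x1 Tx1 [x2 Ux2 <-]]; apply: add_closed.
  by rewrite scalerDr; apply: addP; [apply: TZ | apply: UZ].
- move=> [x1 Tx1 [x2 Ux2 <-]] [y1 Ty1 [y2 Uy2 <-]].
  (* Of the four products, [x1 * y1] stays in [T] and [x2 * y2] in [U]; the other two are mixed,
     once [x2 * y1] is commuted. *)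
  rewrite mulrDl !mulrDr [x2 * y1]mulrC.
  apply: (add_closed _ _ (add_closed _ _ _ _) (add_closed _ _ _ _));
    try exact: mixed.
  + by rewrite -[_ * _]addr0; apply: addP => //; apply: TM.
  + by rewrite -[_ * _]add0r; apply: addP => //; apply: UM.
Qed.

End QuadraticExtension.

Theorem proposition5p11 (R : comNzRingType) (S : comAlgType R) (t : S)
    (hR : SPIR R)
    (hext : ring_extension S)
    (hproper : base_ring S `<` [set: S])
    (hadjoin : [set: S] = adjoin t)
    (ht : idempotent_elt t \/ nilpotent_of_index t 2) :
  FIP S /\ Delta_extension S.
Proof.
have [e t2] : exists e : R, t * t = e *: t.
  case: ht => [tt|[tt _]]; first by exists 1; rewrite scale1r.
  by exists 0; rewrite scale0r -expr2.
by split; [apply: FIP_adjoin t2 hadjoin hR | apply: Delta_extension_adjoin t2 hadjoin].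
Qed.
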